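(* Let $f:\mathbb{R}^n\to\mathbb{R}$ and let $\{x_k\}$ be the iterates generated by the Full-Low Evaluation algorithm (described in the context, with constants $c\in(0,1)$, $\bar\beta>0$, $\tau\in(0,1)$). Assume: (1) $f$ is continuously differentiable and $\nabla f$ is Lipschitz continuous with constant $L>0$; (2) there is $u_g>0$, independent of $k$, such that $\|\nabla f(x_k)-g_k\|\le u_g\,\beta_k\,\|g_k\|$ for every successful Full-Eval iteration $k$; (3) there are constants $\kappa,u_p>0$ such that, for every Full-Eval iteration $k$, $\frac{(-g_k)^\top p_k}{\|g_k\|\,\|p_k\|}>\kappa$ and $\|g_k\|\le u_p\|p_k\|$; (4) $f$ is strongly convex: there is $\mu>0$ such that $f(y)\ge f(x)+\nabla f(x)^\top(y-x)+\frac{\mu}{2}\|y-x\|^2$ for all $x,y\in\mathbb{R}^n$. Let $x_*$ be the unique minimizer of $f$, let $ns_k=|\mathcal{I}_{SF}\cap\{0,\ldots,k-1\}|$, and let $$\eta_\mu=\frac{2\mu c}{(\bar\beta u_g+1)^2}\,\min\left(\bar\beta\,\frac{\kappa}{u_p},\ \frac{2\tau\kappa^2(1-c)}{2u_gu_p+L}\right).$$ Then, for every $k$ with $k-1\in\mathcal{I}_{SF}$, $$f(x_k)-f(x_* )\ \le\ (1-\eta_\mu)^{ns_k}\,\bigl(f(x_0)-f(x_* )\bigr).$$ Moreover, if $c\in(0,1/2)$, then $\eta_\mu\in(0,1)$.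
   Context: All norms are Euclidean. The Full-Low Evaluation algorithm minimizes $f:\mathbb{R}^n\to\mathbb{R}$ (with $n\ge1$) from an initial iterate $x_0$. Constants independent of $k$: $c\in(0,1)$, $\gamma>0$, $\bar\beta>0$, $\tau\in(0,1)$, $\lambda\ge 1$, $\theta\in(0,1)$, an initial direct-search stepsize $\alpha_0>0$, and a positive forcing function $\rho$. Each iteration $k=0,1,2,\ldots$ has a type $t_k\in\{\text{Full-Eval},\text{Low-Eval}\}$, with $t_0=$ Full-Eval. Full-Eval iteration (line search): compute an approximate gradient $g_k\in\mathbb{R}^n$ and a direction $p_k\in\mathbb{R}^n$. Try successively $\beta=\bar\beta,\tau\bar\beta,\tau^2\bar\beta,\ldots$ until either (a) $\beta<\gamma\rho(\alpha_k)$, in which case the iteration is unsuccessful, $x_{k+1}=x_k$ and $t_{k+1}=$ Low-Eval; or (b) $\beta\ge\gamma\rho(\alpha_k)$ and $f(x_k+\beta p_k)\le f(x_k)+c\,\beta\,g_k^\top p_k$, in which case the iteration is successful, $\beta_k=\beta$, $x_{k+1}=x_k+\beta_kp_k$ and $t_{k+1}=$ Full-Eval. For each trial $\beta$, condition (a) is checked first. In both cases $\alpha_{k+1}=\alpha_k$. Low-Eval iteration (direct search): generate a finite set $D_k$ of non-zero directions. If $f(x_k+\alpha_kd_k)\le f(x_k)-\rho(\alpha_k)$ for some $d_k\in D_k$, the iteration is successful, $x_{k+1}=x_k+\alpha_kd_k$ and $\alpha_{k+1}=\lambda\alpha_k$; otherwise it is unsuccessful, $x_{k+1}=x_k$ and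 $\alpha_{k+1}=\theta\alpha_k$. In either case $t_{k+1}\in\{\text{Full-Eval},\text{Low-Eval}\}$ is chosen by an arbitrary rule. $\mathcal{I}_{SF}$ denotes the set of indices of successful Full-Eval iterations. *)

(* Defs.v *)
From HB Require Import structures.
From mathcomp Require Import all_boot all_order all_algebra.
From mathcomp Require Import all_classical all_reals all_analysis.
Import Order.TTheory GRing.Theory Num.Theory numFieldNormedType.Exports.

Set Implicit Arguments.
Unset Strict Implicit.
Unset Printing Implicit Defensive.

Local Open Scope classical_set_scope.
Local Open Scope ring_scope.

(** The library norm on ['rV[R]_n] is the max norm, so the Euclidean one is
    defined here. [differentiable] and [continuous] do not depend on which of
    the two is used. *)

Definition dot (R : realType) (n : nat) (u v : 'rV[R]_n) : R :=
  \sum_(i < n) u 0 i * v 0 i.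

Definition enorm (R : realType) (n : nat) (u : 'rV[R]_n) : R :=
  Num.sqrt (dot u u).

Section Smoothness.
Variables (R : realType) (n : nat) (f : 'rV[R]_n -> R).

Definition gradient (x : 'rV[R]_n) : 'rV[R]_n :=
  \row_(i < n) 'D_(delta_mx 0 i) f x.

Definition continuously_differentiable : Prop :=
  (forall x, differentiable f x) /\ continuous gradient.

Definition lipschitz_gradient (L : R) : Prop :=
  forall x y, enorm (gradient x - gradient y) <= L * enorm (x - y).

Definition strongly_convex (mu : R) : Prop :=
  forall x y,
    f x + dot (gradient x) (y - x) + mu / 2 * enorm (y - x) ^+ 2 <= f y.

Definition minimizer (z : 'rV[R]_n) : Prop := forall y, f z <= f y.

End Smoothness.

(** Forcing functions are often also required to be continuous and
    nondecreasing; this is not assumed here. Values outside of the positive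
    reals are irrelevant, since all stepsizes are positive. *)
Definition forcing (R : realType) (rho : R -> R) : Prop :=
  (forall t, 0 < t -> 0 < rho t) /\ (rho t / t @[t --> 0^'+] --> 0).

Record fle_constants (R : realType) := FLEConstants {
  c : R;         (* sufficient decrease in the line search *)
  gamma : R;     (* line search abandoned below [gamma * rho alpha] *)
  betabar : R;   (* first trial stepsize *)
  tau : R;       (* backtracking factor *)
  lambda : R;    (* direct-search expansion factor *)
  theta : R;     (* direct-search contraction factor *)
  alpha0 : R;    (* initial direct-search stepsize *)
  rho : R -> R   (* forcing function *)
}.

Definition valid_constants (R : realType) (C : fle_constants R) : Prop :=
  [/\ 0 < c C < 1, 0 < gamma C, 0 < betabar C & 0 < tau C < 1] /\
  [/\ 1 <= lambda C, 0 < theta C < 1, 0 < alpha0 C & forcing (rho C)].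

Variant iter_type := FullEval | LowEval.

Definition is_full (t : iter_type) : bool :=
  if t is FullEval then true else false.

(** The data of a run. [grad_approx k] and [direction k] are meaningful only if
    iteration [k] is Full-Eval, [ls_step k] (the accepted stepsize) only if it
    is moreover successful, and [poll k] only if it is Low-Eval. *)
Record fle_trace (R : realType) (n : nat) := FLETrace {
  iterate : nat -> 'rV[R]_n;
  kind : nat -> iter_type;
  successful : nat -> bool;
  ds_step : nat -> R;
  grad_approx : nat -> 'rV[R]_n;
  direction : nat -> 'rV[R]_n;
  ls_step : nat -> R;
  poll : nat -> set 'rV[R]_n
}.

Section Algorithm.
Variables (R : realType) (n : nat) (f : 'rV[R]_n -> R) (C : fle_constants R).

Definition trial (j : nat) : R := tau C ^+ j * betabar C.

Definition too_small (alpha beta : R) : bool := beta < gamma C * rho C alpha.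

Definition armijo (x g p : 'rV[R]_n) (beta : R) : bool :=
  f (x + beta *: p) <= f x + c C * beta * dot g p.

Variable T : fle_trace R n.

Local Notation x := (iterate T).
Local Notation alpha := (ds_step T).
Local Notation g := (grad_approx T).
Local Notation p := (direction T).
Local Notation beta := (ls_step T).
Local Notation D := (poll T).

(** Backtracking at iteration [k] has stopped on none of the first [j] trial
    stepsizes. *)
Definition ls_reaches (k j : nat) : Prop :=
  forall i, (i < j)%N ->
    ~~ too_small (alpha k) (trial i) /\ ~~ armijo (x k) (g k) (p k) (trial i).

Definition full_eval_success (k : nat) : Prop :=
  (exists j, [/\ ls_reaches k j, ~~ too_small (alpha k) (trial j),
                 armijo (x k) (g k) (p k) (trial j) & beta k = trial j]) /\
  x k.+1 = x k + beta k *: p k /\ kind T k.+1 = FullEval.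

Definition full_eval_failure (k : nat) : Prop :=
  (exists j, ls_reaches k j /\ too_small (alpha k) (trial j)) /\
  x k.+1 = x k /\ kind T k.+1 = LowEval.

Definition full_eval (k : nat) : Prop :=
  (if successful T k then full_eval_success k else full_eval_failure k) /\
  alpha k.+1 = alpha k.

Definition ds_decrease (k : nat) (d : 'rV[R]_n) : bool :=
  f (x k + alpha k *: d) <= f (x k) - rho C (alpha k).

Definition low_eval_success (k : nat) : Prop :=
  (exists d, [/\ D k d, ds_decrease k d & x k.+1 = x k + alpha k *: d]) /\
  alpha k.+1 = lambda C * alpha k.

Definition low_eval_failure (k : nat) : Prop :=
  [/\ forall d, D k d -> ~~ ds_decrease k d,
      x k.+1 = x k & alpha k.+1 = theta C * alpha k].

(** The type of the next iteration is left free. *)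
Definition low_eval (k : nat) : Prop :=
  [/\ finite_set (D k), forall d, D k d -> d != 0 &
      if successful T k then low_eval_success k else low_eval_failure k].

Definition fle_run : Prop :=
  [/\ kind T 0%N = FullEval, alpha 0%N = alpha0 C &
      forall k, if is_full (kind T k) then full_eval k else low_eval k].

Definition succ_full (k : nat) : bool := is_full (kind T k) && successful T k.

Definition ns (k : nat) : nat := #|[set i : 'I_k | succ_full i]%SET|.

End Algorithm.

Definition eta_mu (R : realType) (C : fle_constants R) (mu ug kappa up L : R) : R :=
  2 * mu * c C / (betabar C * ug + 1) ^+ 2 *
  Num.min (betabar C * (kappa / up))
          (2 * tau C * kappa ^+ 2 * (1 - c C) / (2 * ug * up + L)).

(* Main.v *)
Require Import Defs.
From HB Require Import structures.
From mathcomp Require Import all_boot all_order all_algebra.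
From mathcomp Require Import all_classical all_reals all_analysis.
From mathcomp Require Import ring lra.
Import Order.TTheory GRing.Theory Num.Theory numFieldNormedType.Exports.
Local Open Scope ring_scope.

(** The gap [f x - f z] to a minimizer [z] shrinks by the factor [1 - eta_mu] at
    each successful Full-Eval iteration and does not grow at any other one, so
    that after [k] iterations it has shrunk by the [ns T k]-th power of it.

    The shrinking combines three facts about an iteration with approximate
    gradient [g], direction [p], accepted stepsize [beta] and true gradient [G].
    - The line search decreases [f] by at least [c * beta * (- dot g p)], and
      [beta * (- dot g p)] is at least [step_factor * |g|^2], where
      [step_factor] is the minimum appearing in [eta_mu]. If the first trial
      stepsize is accepted, this is the angle condition together with
      [|g| <= up * |p|]. Otherwise [beta / tau] was rejected, and comparing the
      failed Armijo test with the descent lemma for Lipschitz gradients bounds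
      [beta / tau] from below ([line_search_decrease]).
    - The accuracy condition gives [|G| <= (betabar * ug + 1) * |g|]
      ([gradient_le_approx]).
    - Strong convexity gives the Polyak-Lojasiewicz inequality
      [2 * mu * (f x - f z) <= |G|^2] ([gradient_dominance]).

    Passing to powers needs [0 <= 1 - eta_mu], for every admissible [c]. As soon
    as a successful Full-Eval iteration exists this is automatic: that iteration
    strictly decreases [f], so the gap before it is positive, while the gap
    after it is nonnegative ([one_sub_eta_ge0]). The bound [eta_mu < 1] itself
    follows from [4 * c * (1 - c) <= 1], [tau < 1], [kappa < 1] (Cauchy-Schwarz
    at iteration 0, which is Full-Eval) and [mu <= L] ([eta_mu_bounds]).

    The minimizer exists because strong convexity makes [f] exceed [f 0] outside
    a compact box. *)

(** * Euclidean geometry of row vectors *)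

Section Euclidean.
Context {R : realType} {n : nat}.
Implicit Types (u v w : 'rV[R]_n) (a : R).

Lemma dotC u v : dot u v = dot v u.
Proof. by apply: eq_bigr => i _; rewrite mulrC. Qed.

Lemma dotDl u v w : dot (u + v) w = dot u w + dot v w.
Proof. by rewrite -big_split; apply: eq_bigr => i _ /=; rewrite mxE mulrDl. Qed.

Lemma dotZl a u v : dot (a *: u) v = a * dot u v.
Proof. by rewrite mulr_sumr; apply: eq_bigr => i _; rewrite mxE mulrA. Qed.

Lemma dotNl u v : dot (- u) v = - dot u v.
Proof. by rewrite -scaleN1r dotZl mulN1r. Qed.

Lemma dotDr u v w : dot u (v + w) = dot u v + dot u w.
Proof. by rewrite dotC dotDl !(dotC u). Qed.

Lemma dotZr a u v : dot u (a *: v) = a * dot u v.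
Proof. by rewrite dotC dotZl (dotC u). Qed.

Lemma dotNr u v : dot u (- v) = - dot u v.
Proof. by rewrite dotC dotNl (dotC u). Qed.

Lemma dot_ge0 u : 0 <= dot u u.
Proof. by apply: sumr_ge0 => i _; rewrite -expr2 sqr_ge0. Qed.

Lemma dot_eq0 u : (dot u u == 0) = (u == 0).
Proof.
apply/eqP/eqP => [u0|->]; last by rewrite -(scale0r 0) dotZl mul0r.
apply/rowP => i; rewrite mxE; apply/eqP; rewrite -sqrf_eq0 expr2.
by have /psumr_eq0P -> := u0 => // j _; rewrite -expr2 sqr_ge0.
Qed.

Lemma enorm_ge0 u : 0 <= enorm u.
Proof. exact: sqrtr_ge0. Qed.

Lemma sqr_enorm u : enorm u ^+ 2 = dot u u.
Proof. by rewrite sqr_sqrtr // dot_ge0. Qed.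

Lemma enorm_eq0 u : (enorm u == 0) = (u == 0).
Proof. by rewrite -sqrf_eq0 sqr_enorm dot_eq0. Qed.

Lemma enorm_gt0 u : (0 < enorm u) = (u != 0).
Proof. by rewrite lt_def enorm_eq0 enorm_ge0 andbT. Qed.

Lemma enormZ a u : enorm (a *: u) = `|a| * enorm u.
Proof. by rewrite /enorm dotZl dotZr mulrA -expr2 sqrtrM ?sqr_ge0 // sqrtr_sqr. Qed.

Lemma enormN u : enorm (- u) = enorm u.
Proof. by rewrite -scaleN1r enormZ normrN1 mul1r. Qed.

(** The Cauchy-Schwarz inequality, obtained by expanding the square of
    [|v| u - |u| v]. *)
Lemma dot_le_enorm u v : dot u v <= enorm u * enorm v.
Proof.
have [->|u0] := eqVneq u 0.
  by rewrite -(scale0r 0) dotZl mul0r mulr_ge0 ?enorm_ge0.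
have [->|v0] := eqVneq v 0.
  by rewrite -(scale0r 0) dotZr mul0r mulr_ge0 ?enorm_ge0.
rewrite -!enorm_gt0 in u0 v0.
have := dot_ge0 (enorm v *: u - enorm u *: v).
rewrite !(dotDl, dotDr, dotNl, dotNr, dotZl, dotZr) -!sqr_enorm (dotC v u) => h.
rewrite -subr_ge0 -(pmulr_rge0 _ (mulr_gt0 u0 v0)); move: h; nra.
Qed.

Lemma enormD u v : enorm (u + v) <= enorm u + enorm v.
Proof.
rewrite -(ler_pXn2r (ltn0Sn 1)) ?nnegrE ?addr_ge0 ?enorm_ge0 //.
rewrite sqr_enorm dotDl !dotDr -!sqr_enorm (dotC v u).
by have := dot_le_enorm u v; nra.
Qed.

Lemma coord_le_enorm u i : `|u 0 i| <= enorm u.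
Proof.
rewrite -(ler_pXn2r (ltn0Sn 1)) ?nnegrE ?enorm_ge0 // real_normK ?num_real //.
rewrite sqr_enorm /dot (bigD1 i) //= expr2 lerDl.
by apply: sumr_ge0 => j _; rewrite -expr2 sqr_ge0.
Qed.

End Euclidean.

(** * The descent lemma *)

Section Smooth.
Context {R : realType} {n : nat} {f : 'rV[R]_n -> R}.
Hypothesis diff_f : forall x, differentiable f x.

Lemma derive_dot_gradient x d : 'D_d f x = dot (gradient f x) d.
Proof.
rewrite deriveE // {1}(row_sum_delta d) linear_sum.
by apply: eq_bigr => i _; rewrite linearZ mxE deriveE // mulrC.
Qed.

(** Both difference quotients are the same function of the increment, so the
    derivative along a line is the directional derivative. *)
Lemma is_derive_line x d (t : R) :
  is_derive t 1 (fun s => f (x + s *: d)) (dot (gradient f (x + t *: d)) d).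
Proof.
have E : (fun h => h^-1 *: (((fun s => f (x + s *: d)) \o shift t) (h *: 1) -
                           f (x + t *: d))) =
         (fun h => h^-1 *: ((f \o shift (x + t *: d)) (h *: d) - f (x + t *: d))).
  apply/funext => h /=; congr (_ *: (f _ - _)).
  by rewrite scalerDl /GRing.scale /= mulr1 addrCA.
apply: DeriveDef; last by rewrite -derive_dot_gradient /derive E.
by rewrite /derivable E; exact: diff_derivable.
Qed.

(** The difference of the two sides, restricted to the segment from [x] to
    [x + d], has nonpositive derivative by the Lipschitz bound; the mean value
    theorem then compares its ends. *)
Lemma descent_lemma {L : R} x d : lipschitz_gradient f L ->
  f (x + d) <= f x + dot (gradient f x) d + L / 2 * enorm d ^+ 2.
Proof.
move=> lip.
pose a := dot (gradient f x) d; pose b := L * enorm d ^+ 2.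
pose phi (t : R) := f (x + t *: d) - (a * t + b / 2 * t ^+ 2).
pose dphi (t : R) := dot (gradient f (x + t *: d)) d - (a + b * t).
have dphiE (t : R) : is_derive t 1 phi (dphi t).
  have q : is_derive t 1 (fun s : R => a * s + b / 2 * s ^+ 2) (a + b * t).
    apply: is_derive_eq.
    rewrite /GRing.scale /=; lra.
  exact: is_deriveB (is_derive_line x d t) q.
have [] := @MVT R phi dphi 0 1 ltr01 (fun t _ => dphiE t).
  apply: continuous_subspaceT => t.
  by apply/differentiable_continuous/derivable1_diffP; have [] := dphiE t.
move=> t /[!in_itv] /= /andP[t0 t1]; rewrite /phi /dphi scale1r scale0r addr0.
have : dot (gradient f (x + t *: d) - gradient f x) d <= b * t.
  apply: le_trans (dot_le_enorm _ _) _.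
  apply: le_trans (ler_wpM2r (enorm_ge0 _) (lip _ _)) _.
  rewrite [x + _]addrC addrK enormZ gtr0_norm // /b; lra.
rewrite dotDl dotNl -/a /b; lra.
Qed.
End Smooth.

(** * Strongly convex functions *)

Section StrongConvexity.
Context {R : realType} {n : nat} {f : 'rV[R]_n -> R} {mu : R}.
Hypothesis mu_gt0 : 0 < mu.
Hypothesis conv : strongly_convex f mu.

(** The Polyak-Lojasiewicz inequality: over all displacements [d], the strong
    convexity lower bound [dot G d + mu / 2 * |d|^2] is at least
    [- |G|^2 / (2 * mu)], as completing the square shows. *)
Lemma gradient_dominance x z :
  2 * mu * (f x - f z) <= enorm (gradient f x) ^+ 2.
Proof.
have := conv x z; have := dot_ge0 (gradient f x + mu *: (z - x)).
move: (z - x) => d.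
rewrite dotDl !dotDr !dotZl !dotZr (dotC _ (gradient f x)) -!sqr_enorm.
set G := enorm (gradient f x) ^+ 2; set D := enorm _ ^+ 2; set P := dot _ _.
move=> h1 h2.
have /(ler_wpM2l (ltW mu_gt0)) : P + mu / 2 * D <= f z - f x by lra.
lra.
Qed.

(** Adding the strong convexity inequalities from [0] to [e] and from [e] to [0]
    gives [mu * |e|^2 <= dot (G e - G 0) e], which is at most [L * |e|^2]. A
    nonzero [e] exists only in positive dimension. *)
Lemma strong_convexity_le_lipschitz (L : R) :
  (0 < n)%N -> lipschitz_gradient f L -> mu <= L.
Proof.
move=> n0 lip; pose e : 'rV[R]_n := const_mx 1.
have e0 : 0 < enorm e.
  rewrite enorm_gt0; apply/eqP => /rowP /(_ (Ordinal n0)) /eqP.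
  by rewrite !mxE oner_eq0.
have := conv 0 e; have := conv e 0.
rewrite subr0 sub0r enormN dotNr => h1 h2.
have : dot (gradient f e - gradient f 0) e <= L * enorm e ^+ 2.
  apply: le_trans (dot_le_enorm _ _) _.
  rewrite expr2 mulrA; apply: ler_wpM2r; first exact: enorm_ge0.
  by have := lip e 0; rewrite subr0.
rewrite dotDl dotNl => h3.
by rewrite -(ler_pM2r (exprn_gt0 2 e0)); lra.
Qed.

(** Strong convexity at the midpoint makes the average of [f y] and [f z] exceed
    the value there by a multiple of [|y - z|^2]. *)
Lemma minimizer_unique y z : minimizer f y -> minimizer f z -> y = z.
Proof.
move=> ymin zmin; pose m := 2^-1 *: (y + z).
have ym : y - m = 2^-1 *: (y - z).
  by apply/rowP => i; rewrite !mxE; field.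
have zm : z - m = - (2^-1 *: (y - z)).
  by apply/rowP => i; rewrite !mxE; field.
have := conv m z; have := conv m y; have := ymin m; have := zmin m.
rewrite ym zm dotNr enormN => h1 h2 h3 h4.
have D0 : enorm (2^-1 *: (y - z)) ^+ 2 <= 0.
  by rewrite -(ler_pM2l mu_gt0) mulr0; lra.
apply/eqP; move: D0; rewrite exprn_even_le0 //= enorm_eq0 scaler_eq0 subr_eq0.
by rewrite invr_eq0 pnatr_eq0.
Qed.

(** Outside the ball of radius [2 * |G 0| / mu] the quadratic term of the strong
    convexity bound at [0] dominates the linear one, so a minimum over a box
    containing that ball is global. *)
Lemma minimizer_exists :
  (forall x, differentiable f x) -> exists z, minimizer f z.
Proof.
move=> df; pose r := 2 * enorm (gradient f 0) / mu.
have r0 : 0 <= r by rewrite mulr_ge0 ?mulr_ge0 ?enorm_ge0 // invr_ge0 ltW.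
pose box := [set y : 'rV[R]_n | forall i, `[- r, r]%classic (y ord0 i)]%classic.
have box0 : box 0 by move=> i; rewrite /= in_itv /= mxE oppr_le0 r0.
have cbox : compact box.
  apply: (@rV_compact _ _ (fun=> `[- r, r]%classic)) => _.
  exact: segment_compact.
have [||z zbox zmin] := @EVT_min_rV R n f box _ cbox.
- by exists 0.
- by apply: continuous_subspaceT => y; exact: differentiable_continuous.
exists z => y; case: (pselect (box y)) => [ybox|ybox].
  by apply: zmin; rewrite inE.
have fz0 : f z <= f 0 by apply: zmin; rewrite inE.
apply: le_trans fz0 _.
have ry : r < enorm y.
  rewrite ltNge; apply/negP => yr; apply: ybox => i /=.
  by rewrite in_itv /= -ler_norml (le_trans (coord_le_enorm _ _)).
have := conv 0 y; have := dot_le_enorm (gradient f 0) (- y).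
rewrite dotNr enormN subr0.
have : 2 * enorm (gradient f 0) <= mu * enorm y.
  by move: ry; rewrite /r ltr_pdivrMr // mulrC => /ltW; lra.
move/(ler_wpM2r (enorm_ge0 y)); lra.
Qed.
End StrongConvexity.

(** * The line search *)

Section LineSearch.
Context {R : realType} {n : nat} {f : 'rV[R]_n -> R} {C : fle_constants R}.
Hypothesis hC : valid_constants C.

Lemma trial_gt0 j : 0 < trial C j.
Proof.
by have [[_ _ b0 /andP[t0 _]] _] := hC; rewrite mulr_gt0 ?exprn_gt0.
Qed.

Lemma trial_le_betabar j : trial C j <= betabar C.
Proof.
have [[_ _ b0 /andP[t0 t1]] _] := hC.
by rewrite ler_piMl ?exprn_ile1 ?ltW.
Qed.

(** Division by zero yields zero, so a positive lower bound on the cosine already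
    excludes zero vectors. *)
Lemma angle_condition {kappa : R} {g p : 'rV[R]_n} : 0 < kappa ->
  kappa < dot (- g) p / (enorm g * enorm p) ->
  [/\ 0 < enorm g, 0 < enorm p & kappa * (enorm g * enorm p) < - dot g p].
Proof.
move=> k0 h.
have gp0 : enorm g * enorm p != 0.
  apply: contraTneq h => ->; rewrite invr0 mulr0 -leNgt; exact: ltW.
move: (gp0); rewrite mulf_eq0 negb_or !enorm_eq0 -!enorm_gt0 => /andP[g0 p0].
by split=> //; rewrite -dotNl -ltr_pdivlMr // mulr_gt0.
Qed.

Lemma angle_lt1 {kappa : R} {g p : 'rV[R]_n} : 0 < kappa ->
  kappa < dot (- g) p / (enorm g * enorm p) -> kappa < 1.
Proof.
move=> k0 h; have [g0 p0 hk] := angle_condition k0 h.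
have := dot_le_enorm (- g) p; rewrite enormN dotNl => cs.
by rewrite -(ltr_pM2r (mulr_gt0 g0 p0)) mul1r; exact: lt_le_trans cs.
Qed.

(** A stepsize [b] failing the Armijo test cannot be small: the descent lemma
    bounds [f (x + b *: p)] from above in terms of the true gradient, which
    differs from [g] by at most [e], while the failed test bounds it from below
    in terms of [g]. *)
Lemma rejected_step_gt {L e b : R} {x g p : 'rV[R]_n} :
  (forall x, differentiable f x) -> lipschitz_gradient f L -> 0 < b ->
  enorm (gradient f x - g) <= e -> ~~ armijo f C x g p b ->
  (1 - c C) * - dot g p < e * enorm p + L / 2 * b * enorm p ^+ 2.
Proof.
move=> df lip b0 he; rewrite /armijo -ltNge => rej.
have := descent_lemma df x (b *: p) lip; rewrite dotZr enormZ gtr0_norm // => hd.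
have cs := le_trans (dot_le_enorm _ _) (ler_wpM2r (enorm_ge0 p) he).
rewrite dotDl dotNl in cs.
rewrite -(ltr_pM2l b0); move: (ler_wpM2l (ltW b0) cs) hd rej; lra.
Qed.

(** The guaranteed value of [beta * (- dot g p) / |g|^2] at an accepted stepsize
    [beta]: the first entry is for an accepted initial trial, the second one for
    a stepsize reached by backtracking. *)
Definition step_factor (ug kappa up L : R) : R :=
  Num.min (betabar C * (kappa / up))
          (2 * tau C * kappa ^+ 2 * (1 - c C) / (2 * ug * up + L)).

(** If [j > 0], trial [j - 1] was rejected, and the lower bound on it carries
    over to trial [j] at the cost of a factor [tau]. The accuracy hypothesis
    concerns the accepted trial only; being proportional to it, the error is a
    fraction [tau] of its analogue at the rejected one. *)
Lemma line_search_decrease {L ug kappa up : R} {x g p : 'rV[R]_n} {j : nat} :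
  (forall x, differentiable f x) -> 0 < L -> lipschitz_gradient f L ->
  0 < ug -> 0 < kappa -> 0 < up ->
  (forall i, (i < j)%N -> ~~ armijo f C x g p (trial C i)) ->
  enorm (gradient f x - g) <= ug * trial C j * enorm g ->
  kappa < dot (- g) p / (enorm g * enorm p) -> enorm g <= up * enorm p ->
  step_factor ug kappa up L * enorm g ^+ 2 <= trial C j * - dot g p.
Proof.
move=> df L0 lip ug0 k0 up0 rej acc angle gp.
have [g0 p0 hk] := angle_condition k0 angle.
have [[/andP[c0 c1] _ b0 /andP[t0 t1]] _] := hC.
case: j rej acc => [|j] rej acc.
  rewrite /trial expr0 mul1r.
  apply: (@le_trans _ _ (betabar C * (kappa / up) * enorm g ^+ 2)).
    by apply: ler_wpM2r; rewrite ?sqr_ge0 // /step_factor ge_min lexx.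
  rewrite -mulrA ler_pM2l //; apply: le_trans (ltW hk).
  rewrite -mulrA ler_pM2l // ler_pdivrMl // expr2.
  by have := ler_wpM2l (ltW g0) gp; lra.
have rejj := rej j (leqnn _).
have b'0 := trial_gt0 j.
have trialS : trial C j.+1 = tau C * trial C j by rewrite /trial exprS mulrA.
have := rejected_step_gt df lip b'0 acc rejj; rewrite trialS => h.
set K := 2 * ug * up + L.
have K0 : 0 < K by rewrite addr_gt0 ?mulr_gt0.
(* The error term uses [tau <= 1] to pass to the rejected stepsize, and
   [|g| <= up * |p|] to match the quadratic term. *)
have lower : 2 * (1 - c C) * kappa * enorm g < K * (trial C j * enorm p).
  rewrite -(ltr_pM2r p0).
  have c'0 : 0 < 1 - c C by rewrite subr_gt0.
  have B0 := mulr_gt0 (mulr_gt0 ug0 b'0) p0.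
  have hB := ler_wpM2l (ltW B0) gp.
  have htB := ler_piMl (mulr_ge0 (ltW B0) (ltW g0)) (ltW t1).
  rewrite -(ltr_pM2l c'0) in hk; move: hk h hB htB; rewrite /K; lra.
apply: (@le_trans _ _ (2 * tau C * kappa ^+ 2 * (1 - c C) / K * enorm g ^+ 2)).
  by apply: ler_wpM2r; rewrite ?sqr_ge0 // /step_factor ge_min lexx orbT.
apply: (@le_trans _ _ (tau C * trial C j * (kappa * (enorm g * enorm p)))); last first.
  by rewrite ler_wpM2l // ltW // mulr_gt0.
rewrite mulrAC ler_pdivrMr //.
have := ler_wpM2l (ltW (mulr_gt0 (mulr_gt0 t0 k0) g0)) (ltW lower).
lra.
Qed.

Lemma step_factor_gt0 {ug kappa up L : R} :
  0 < ug -> 0 < kappa -> 0 < up -> 0 < L -> 0 < step_factor ug kappa up L.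
Proof.
move=> ug0 k0 up0 L0; have [[/andP[c0 c1] _ b0 /andP[t0 t1]] _] := hC.
have c'0 : 0 < 1 - c C by rewrite subr_gt0.
have K0 : 0 < 2 * ug * up + L by rewrite addr_gt0 // !mulr_gt0.
rewrite lt_min; apply/andP; split; first by rewrite mulr_gt0 ?divr_gt0.
by rewrite divr_gt0 // (mulr_gt0 _ c'0) // !mulr_gt0 // exprn_gt0.
Qed.
End LineSearch.

(** The second entry of the minimum gives
    [step_factor * L <= 2 * tau * kappa^2 * (1 - c)], so that [eta_mu] is less
    than [4 * c * (1 - c) * tau * kappa^2 * (mu / L)]. *)
Lemma eta_mu_bounds {R : realType} {C : fle_constants R} {mu ug kappa up L : R} :
  valid_constants C -> 0 < ug -> 0 < kappa < 1 -> 0 < up -> 0 < mu <= L ->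
  0 < eta_mu C mu ug kappa up L < 1.
Proof.
move=> hC ug0 /andP[k0 k1] up0 /andP[mu0 muL].
have L0 := lt_le_trans mu0 muL.
have [[/andP[c0 c1] _ b0 /andP[t0 t1]] _] := hC.
have m0 := step_factor_gt0 hC ug0 k0 up0 L0.
have bu0 : 0 < betabar C * ug by exact: mulr_gt0.
rewrite /eta_mu -/(step_factor ug kappa up L) (mulr_gt0 _ m0) /=; last first.
  by rewrite divr_gt0 ?exprn_gt0 ?mulr_gt0 // addr_gt0.
have cc : 4 * c C * (1 - c C) <= 1 by have := sqr_ge0 (1 - 2 * c C); lra.
have tk : tau C * kappa ^+ 2 < 1.
  apply: (@lt_trans _ _ (tau C)) => //.
  by rewrite gtr_pMr // exprn_ilt1 // ltW.
set m := step_factor (C := C) ug kappa up L in m0 *.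
have mL : m * L <= 2 * tau C * kappa ^+ 2 * (1 - c C).
  apply: (@le_trans _ _ (m * (2 * ug * up + L))).
    by rewrite ler_pM2l // lerDr !mulr_ge0 // ltW.
  rewrite -ler_pdivlMr; last by rewrite addr_gt0 // !mulr_gt0.
  by rewrite /m /step_factor ge_min lexx orbT.
have q1 : 1 < (betabar C * ug + 1) ^+ 2.
  by rewrite exprn_egt1 // ltrDr.
rewrite mulrAC ltr_pdivrMr; last by apply: lt_trans q1.
rewrite mul1r; apply: le_lt_trans q1.
have h1 : 2 * mu * c C * m <= 2 * c C * (m * L).
  by have := ler_wpM2l (ltW (mulr_gt0 c0 m0)) muL; lra.
apply: (le_trans h1).
have := ler_wpM2l (ltW c0) mL.
have c'0 : 0 < 1 - c C by rewrite subr_gt0.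
have := mulr_ile1 (ltW (mulr_gt0 t0 (exprn_gt0 2 k0))) _ (ltW tk) cc.
move=> /(_ (ltW (mulr_gt0 (mulr_gt0 (ltr0Sn _ 3) c0) c'0))); lra.
Qed.

(** * Runs of the algorithm *)

Section Run.
Context {R : realType} {n : nat} {f : 'rV[R]_n -> R}.
Context {C : fle_constants R} {T : fle_trace R n}.
Hypothesis hC : valid_constants C.
Hypothesis hT : fle_run f C T.

Lemma ds_step_gt0 k : 0 < ds_step T k.
Proof.
have [_ a0 step] := hT; have [_ [l1 /andP[th0 _] al0 _]] := hC.
elim: k => [|k IH]; first by rewrite a0.
have := step k; case: is_full => [[_ ->] //|[_ _]].
case: successful => [[_ ->]|[_ _ ->]]; rewrite mulr_gt0 //.
exact: lt_le_trans l1.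
Qed.

(** A successful Low-Eval iteration decreases [f] by [rho alpha], which is
    positive because the stepsizes stay positive. *)
Lemma iterate_nonincreasing k :
  ~~ succ_full T k -> f (iterate T k.+1) <= f (iterate T k).
Proof.
have [_ _ /(_ k)] := hT; have [_ [_ _ _ [rho0 _]]] := hC; rewrite /succ_full.
case: is_full => /= [[+ _]|[_ _]]; case: successful => //.
- by move=> [_ [-> _]].
- move=> [[d [_ dec ->]] _] _; apply: le_trans dec _.
  by rewrite gerBl ltW // rho0 // ds_step_gt0.
- by move=> [_ -> _].
Qed.

Lemma succ_fullP {k} : succ_full T k ->
  [/\ is_full (kind T k),
      exists2 j, ls_reaches f C T k j & ls_step T k = trial C j,
      armijo f C (iterate T k) (grad_approx T k) (direction T k) (ls_step T k) &
      iterate T k.+1 = iterate T k + ls_step T k *: direction T k].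
Proof.
have [_ _ /(_ k)] := hT; rewrite /succ_full.
case: is_full => //= [[+ _]] sk; rewrite sk => -[[j [rej _ acc bj]] [xk _]].
by split=> //; [exists j | rewrite bj].
Qed.

Lemma nsE k : ns T k = (\sum_(i < k) succ_full T i)%N.
Proof.
rewrite /ns -sum1_card big_mkcond; apply: eq_bigr => i _.
by rewrite inE; case: (succ_full T i).
Qed.

Context {L ug kappa up mu : R}.
Hypothesis df : forall x, differentiable f x.
Hypothesis L_gt0 : 0 < L.
Hypothesis lip : lipschitz_gradient f L.
Hypothesis ug_gt0 : 0 < ug.
Hypothesis grad_acc : forall k, succ_full T k ->
  enorm (gradient f (iterate T k) - grad_approx T k)
    <= ug * ls_step T k * enorm (grad_approx T k).
Hypothesis kappa_gt0 : 0 < kappa.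
Hypothesis up_gt0 : 0 < up.
Hypothesis dir : forall k, is_full (kind T k) ->
  kappa < dot (- grad_approx T k) (direction T k)
            / (enorm (grad_approx T k) * enorm (direction T k)) /\
  enorm (grad_approx T k) <= up * enorm (direction T k).
Hypothesis mu_gt0 : 0 < mu.
Hypothesis conv : strongly_convex f mu.

Let m := @step_factor R C ug kappa up L.

Lemma full_step_decrease {k} : succ_full T k ->
  f (iterate T k.+1) <=
  f (iterate T k) - c C * (m * enorm (grad_approx T k) ^+ 2).
Proof.
move=> sk; have [fk [j rej bj] acc ->] := succ_fullP sk.
have [angle gp] := dir _ fk; have := grad_acc _ sk; rewrite bj => ga.
have [[/andP[c0 _] _ _ _] _] := hC.
rewrite /armijo bj in acc; apply: (le_trans acc).
have := line_search_decrease hC df L_gt0 lip ug_gt0 kappa_gt0 up_gt0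
  (fun i ij => (rej i ij).2) ga angle gp.
rewrite -/m -(ler_pM2l c0); lra.
Qed.

Lemma gradient_le_approx {k} : succ_full T k ->
  enorm (gradient f (iterate T k)) <=
  (betabar C * ug + 1) * enorm (grad_approx T k).
Proof.
move=> sk; have [_ [j _ bj] _ _] := succ_fullP sk.
have := grad_acc _ sk; rewrite bj.
have := enormD (gradient f (iterate T k) - grad_approx T k) (grad_approx T k).
rewrite subrK => h1 h2.
have h3 := trial_le_betabar hC j.
have := ler_wpM2r (mulr_ge0 (ltW ug_gt0) (enorm_ge0 (grad_approx T k))) h3.
move: h1 h2; lra.
Qed.

(** The decrease is at least [c * step_factor * |g|^2], and [|g|^2] controls the
    squared true gradient, hence the gap itself. *)
Lemma full_step_contraction {k} z : succ_full T k ->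
  f (iterate T k.+1) - f z <=
  (1 - eta_mu C mu ug kappa up L) * (f (iterate T k) - f z).
Proof.
move=> sk; have dec := full_step_decrease sk.
have m0 : 0 < m by exact: step_factor_gt0.
have [[/andP[c0 _] _ b0 _] _] := hC.
have q0 : 0 < betabar C * ug + 1 by rewrite addr_gt0 // mulr_gt0.
have grad2 : enorm (gradient f (iterate T k)) ^+ 2 <=
    (betabar C * ug + 1) ^+ 2 * enorm (grad_approx T k) ^+ 2.
  rewrite -exprMn ler_pXn2r ?nnegrE ?mulr_ge0 ?enorm_ge0 ?(ltW q0) //.
  exact: gradient_le_approx.
have := le_trans (gradient_dominance mu_gt0 conv (iterate T k) z) grad2.
rewrite -ler_pdivrMl ?exprn_gt0 // => h.
have := ler_wpM2l (ltW (mulr_gt0 c0 m0)) h.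
rewrite /eta_mu -/(step_factor ug kappa up L) -/m.
set q := (_ ^+ 2)^-1; move: dec; lra.
Qed.

(** The gap before iteration [k] is positive, since that iteration strictly
    decreases [f]; the gap after it is nonnegative and at most [1 - eta_mu] times
    the former. *)
Lemma one_sub_eta_ge0 {k} z : succ_full T k -> minimizer f z ->
  0 <= 1 - eta_mu C mu ug kappa up L.
Proof.
move=> sk zmin; have [fk _ _ _] := succ_fullP sk.
have [g0 _ _] := angle_condition kappa_gt0 (dir _ fk).1.
have m0 : 0 < m by exact: step_factor_gt0.
have [[/andP[c0 _] _ _ _] _] := hC.
have dec := full_step_decrease sk; have con := full_step_contraction z sk.
have := mulr_gt0 c0 (mulr_gt0 m0 (exprn_gt0 2 g0)) => d0.
have zk := zmin (iterate T k.+1).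
have gap : 0 < f (iterate T k) - f z by lra.
by rewrite -(pmulr_lge0 _ gap); apply: le_trans con; rewrite subr_ge0.
Qed.

Lemma linear_rate k z : minimizer f z ->
  f (iterate T k) - f z <=
  (1 - eta_mu C mu ug kappa up L) ^+ ns T k * (f (iterate T 0) - f z).
Proof.
move=> zmin; elim: k => [|k IH].
  by rewrite nsE big_ord0 expr0 mul1r.
rewrite nsE big_ord_recr /= -nsE; have [sk|nsk] := boolP (succ_full T k); last first.
  by rewrite addn0; apply: le_trans IH; rewrite lerD2r iterate_nonincreasing.
rewrite addn1 exprS -mulrA; apply: le_trans (full_step_contraction z sk) _.
by rewrite ler_wpM2l // (one_sub_eta_ge0 z sk).
Qed.

End Run.

Theorem mainTheorem3 (R : realType) (n : nat) (f : 'rV[R]_n -> R)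
    (C : fle_constants R) (T : fle_trace R n) (L ug kappa up mu : R)
    (hn : (1 <= n)%N)
    (hC : valid_constants C)
    (hT : fle_run f C T)
    (hf : continuously_differentiable f)
    (hL : 0 < L)
    (hlip : lipschitz_gradient f L)
    (hug : 0 < ug)
    (hgrad : forall k, succ_full T k ->
       enorm (gradient f (iterate T k) - grad_approx T k)
         <= ug * ls_step T k * enorm (grad_approx T k))
    (hkappa : 0 < kappa)
    (hup : 0 < up)
    (hdir : forall k, is_full (kind T k) ->
       kappa < dot (- grad_approx T k) (direction T k)
                 / (enorm (grad_approx T k) * enorm (direction T k)) /\
       enorm (grad_approx T k) <= up * enorm (direction T k))
    (hmu : 0 < mu)
    (hconv : strongly_convex f mu) :
  (exists! xstar, minimizer f xstar) /\
  (forall xstar, minimizer f xstar ->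
     forall k, (0 < k)%N -> succ_full T k.-1 ->
       f (iterate T k) - f xstar
         <= (1 - eta_mu C mu ug kappa up L) ^+ ns T k
              * (f (iterate T 0) - f xstar)) /\
  (c C < 1 / 2 -> 0 < eta_mu C mu ug kappa up L < 1).
Proof.
have [df _] := hf; split; last split.
- have [z zmin] := minimizer_exists hmu hconv df.
  by exists z; split=> // y; exact: minimizer_unique hmu hconv _ _ zmin.
- by move=> z zmin k _ _; exact: (linear_rate hC hT df).
move=> _; apply: eta_mu_bounds => //.
  have [kind0 _ _] := hT.
  have [angle _] := hdir 0%N (etrans (congr1 is_full kind0) erefl).
  by rewrite hkappa (angle_lt1 hkappa angle).
by rewrite hmu (strong_convexity_le_lipschitz hconv _ hn hlip).
Qed.
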